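(* Suppose Assumptions (A1)–(A3) hold. Fix any constant $\kappa_2>1$ and set $\kappa_1=\frac{2+3L_f^2}{2\rho_2(L)}$, $\kappa_3=\frac14\big(1+(1+8\kappa_2+\frac{8}{\rho_2(L)})^{1/2}\big)$, $\kappa_4=(\kappa_2+\frac{1}{\rho_2(L)})L_f^2+\big((\kappa_2+\frac{1}{\rho_2(L)})^2L_f^2+2\big)^{1/2}L_f$. Let $\beta>\max\{\frac{\kappa_1}{\kappa_2-1},\kappa_3,\kappa_4\}$, $\alpha\in(\beta+\kappa_1,\kappa_2\beta]$, and define $\epsilon_1=(\alpha-\beta)\rho_2(L)-\frac12(2+3L_f^2)$, $\epsilon_2=\beta^2\rho(L)+(2\alpha^2+\beta^2)\rho^2(L)+\frac52L_f^2$, $\epsilon_3=\beta-\frac12-\frac{\alpha}{2\beta^2}-\frac{1}{2\beta\rho_2(L)}$, $\epsilon_4=2\beta^2+\frac12$, $\epsilon_5=\frac14-\frac{1}{2\beta}(\frac1\beta+\frac{1}{\rho_2(L)}+\frac\alpha\beta)L_f^2$, $\epsilon_6=\frac{1}{\beta^2}(1+\frac{1}{\rho_2(L)}+\frac\alpha\beta)L_f^2+\frac{L_f(1+L_f)}{2}$. Let $\eta\in(0,\min\{\epsilon_1/\epsilon_2,\epsilon_3/\epsilon_4,\epsilon_5/\epsilon_6\})$ and set $\epsilon_7=\eta\min\{\epsilon_1-\eta\epsilon_2,\ \epsilon_3-\eta\epsilon_4,\ \epsilon_5-\eta\epsilon_6,\ \frac14\}$, $\epsilon_8=\frac{\alpha+\beta}{2\beta}+\frac{1}{2\rho_2(L)}$.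 Let $\{\boldsymbol x_k\}$ be generated by Algorithm 1 with these $\alpha,\beta,\eta$. Then for all $T\in\mathbb N_0$, $$\frac{1}{T+1}\sum_{k=0}^T W_k\le \frac{\epsilon_8\hat V_0}{\epsilon_7(T+1)},\qquad f(\bar x_{T+1})-f^*\le \frac{\epsilon_8\hat V_0}{n}.$$
   Context: Network of $n$ agents communicating over a weighted undirected graph $\mathcal G$ with symmetric nonnegative adjacency matrix $A=(a_{ij})$, $a_{ii}=0$, Laplacian $L=(L_{ij})=\mathrm{diag}(A\mathbf 1_n)-A$. $\rho(L)$ is the largest eigenvalue of $L$ and $\rho_2(L)$ its smallest positive eigenvalue. Each agent $i$ has $f_i:\mathbb R^p\to\mathbb R$; $f(x)=\frac1n\sum_{i=1}^n f_i(x)$, $\mathbb X^*=\arg\min f$, $f^*=\min f$. Assumptions: (A1) $\mathcal G$ is connected; (A2) $\mathbb X^*\neq\emptyset$ and $f^*>-\infty$; (A3) each $f_i$ is differentiable with $\|\nabla f_i(x)-\nabla f_i(y)\|\le L_f\|x-y\|$ for all $x,y$, for some $L_f>0$. Algorithm 1 (parameters $\alpha,\beta,\eta>0$): arbitrary $x_{i,0}\in\mathbb R^p$, $v_{i,0}\in\mathbb R^p$ with $\sum_{j=1}^n v_{j,0}=\mathbf 0_p$ (e.g. $v_{i,0}=\mathbf 0_p$), and for $k\ge0$, $i\in[n]$: $x_{i,k+1}=x_{i,k}-\eta\big(\alpha\sum_{j=1}^n L_{ij}x_{j,k}+\beta v_{i,k}+\nabla f_i(x_{i,k})\big)$, $v_{i,k+1}=v_{i,k}+\eta\beta\sum_{j=1}^nL_{ij}x_{j,k}$.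 Notation: $\boldsymbol x_k=\mathrm{col}(x_{1,k},\dots,x_{n,k})$, $\boldsymbol v_k=\mathrm{col}(v_{1,k},\dots,v_{n,k})$, $\boldsymbol K=(I_n-\frac1n\mathbf 1_n\mathbf 1_n^\top)\otimes I_p$, $\boldsymbol H=\frac1n(\mathbf 1_n\mathbf 1_n^\top)\otimes I_p$, $\|z\|_M^2=z^\top Mz$. $\bar x_k=\frac1n\sum_i x_{i,k}$, $\bar{\boldsymbol x}_k=\mathbf 1_n\otimes \bar x_k$, $\boldsymbol g_k=\mathrm{col}(\nabla f_1(x_{1,k}),\dots,\nabla f_n(x_{n,k}))$, $\bar{\boldsymbol g}_k=\boldsymbol H\boldsymbol g_k$, $\boldsymbol g_k^0=\mathrm{col}(\nabla f_1(\bar x_k),\dots,\nabla f_n(\bar x_k))$, $\bar{\boldsymbol g}^0_k=\boldsymbol H\boldsymbol g^0_k=\mathbf 1_n\otimes\nabla f(\bar x_k)$. $\hat V_k=\|\boldsymbol x_k\|^2_{\boldsymbol K}+\|\boldsymbol v_k+\frac1\beta\boldsymbol g_k^0\|^2_{\boldsymbol K}+n(f(\bar x_k)-f^* )$, $W_k=\|\boldsymbol x_k-\bar{\boldsymbol x}_k\|^2+\|\boldsymbol v_k+\frac1\beta\boldsymbol g^0_k\|^2_{\boldsymbol K}+\|\bar{\boldsymbol g}_k\|^2+\|\bar{\boldsymbol g}_k^0\|^2$. *)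

(* Defs.v *)
From mathcomp Require Import ssreflect ssrfun ssrbool eqtype ssrnat seq fintype bigop.
From Stdlib Require Import Reals Relations.

Set Implicit Arguments.
Unset Strict Implicit.

Local Open Scope R_scope.

Definition sumR (n : nat) (F : 'I_n -> R) : R := \big[Rplus/0]_(i < n) F i.

Definition vec (p : nat) := 'I_p -> R.
Definition dot (p : nat) (u w : vec p) : R := sumR (fun c => u c * w c).
Definition normsq (p : nat) (u : vec p) : R := dot u u.
Definition norm (p : nat) (u : vec p) : R := sqrt (normsq u).
Definition vadd (p : nat) (u w : vec p) : vec p := fun c => u c + w c.
Definition vsub (p : nat) (u w : vec p) : vec p := fun c => u c - w c.

Definition is_gradient (p : nat) (f : vec p -> R) (g : vec p -> vec p) : Prop :=
  forall x : vec p, forall eps : R, 0 < eps ->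
    exists delta : R, 0 < delta /\
      forall h : vec p, norm h < delta ->
        Rabs (f (vadd x h) - f x - dot (g x) h) <= eps * norm h.

Definition svec (n p : nat) := 'I_n -> vec p.
Definition snormsq (n p : nat) (z : svec n p) : R := sumR (fun i => normsq (z i)).
Definition savg (n p : nat) (z : svec n p) : vec p :=
  fun c => / INR n * sumR (fun i => z i c).
(* H z = (1/n)(1 1^T (x) I_p) z *)
Definition Hmul (n p : nat) (z : svec n p) : svec n p := fun _ => savg z.
(* ||z||_K^2 = z^T ((I_n - (1/n) 1 1^T) (x) I_p) z
             = sum_i ||z_i||^2 - (1/n) ||sum_i z_i||^2 *)
Definition Knormsq (n p : nat) (z : svec n p) : R :=
  snormsq z - / INR n * normsq (fun c => sumR (fun i => z i c)).

Definition laplacian (n : nat) (A : 'I_n -> 'I_n -> R) : 'I_n -> 'I_n -> R :=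
  fun i j => (if i == j then sumR (fun k => A i k) else 0) - A i j.

Definition is_eigenvalue (n : nat) (M : 'I_n -> 'I_n -> R) (lam : R) : Prop :=
  exists v : 'I_n -> R, (exists i, v i <> 0) /\
    forall i, sumR (fun j => M i j * v j) = lam * v i.

Definition is_largest_eigenvalue (n : nat) (M : 'I_n -> 'I_n -> R) (r : R) : Prop :=
  is_eigenvalue M r /\ forall l, is_eigenvalue M l -> l <= r.

Definition is_smallest_pos_eigenvalue (n : nat) (M : 'I_n -> 'I_n -> R) (r : R) : Prop :=
  is_eigenvalue M r /\ 0 < r /\ forall l, is_eigenvalue M l -> 0 < l -> r <= l.

Definition weighted_undirected (n : nat) (A : 'I_n -> 'I_n -> R) : Prop :=
  (forall i j, A i j = A j i) /\ (forall i j, 0 <= A i j) /\ (forall i, A i i = 0).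

Definition graph_connected (n : nat) (A : 'I_n -> 'I_n -> R) : Prop :=
  forall i j : 'I_n, clos_refl_trans 'I_n (fun a b => 0 < A a b) i j.

Definition fglob (n p : nat) (fs : 'I_n -> vec p -> R) (x : vec p) : R :=
  / INR n * sumR (fun i => fs i x).

Definition kappa_1 (Lf r2 : R) : R := (2 + 3 * Lf ^ 2) / (2 * r2).
Definition kappa_3 (k2 r2 : R) : R := / 4 * (1 + sqrt (1 + 8 * k2 + 8 / r2)).
Definition kappa_4 (Lf k2 r2 : R) : R :=
  (k2 + / r2) * Lf ^ 2 + sqrt ((k2 + / r2) ^ 2 * Lf ^ 2 + 2) * Lf.

Definition epsilon1 (Lf r2 alpha beta : R) : R := (alpha - beta) * r2 - / 2 * (2 + 3 * Lf ^ 2).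
Definition epsilon2 (Lf r alpha beta : R) : R :=
  beta ^ 2 * r + (2 * alpha ^ 2 + beta ^ 2) * r ^ 2 + 5 / 2 * Lf ^ 2.
Definition epsilon3 (r2 alpha beta : R) : R :=
  beta - / 2 - alpha / (2 * beta ^ 2) - / (2 * beta * r2).
Definition epsilon4 (beta : R) : R := 2 * beta ^ 2 + / 2.
Definition epsilon5 (Lf r2 alpha beta : R) : R :=
  / 4 - / (2 * beta) * (/ beta + / r2 + alpha / beta) * Lf ^ 2.
Definition epsilon6 (Lf r2 alpha beta : R) : R :=
  / beta ^ 2 * (1 + / r2 + alpha / beta) * Lf ^ 2 + Lf * (1 + Lf) / 2.
Definition epsilon7 (Lf r r2 alpha beta eta : R) : R :=
  eta * Rmin (Rmin (epsilon1 Lf r2 alpha beta - eta * epsilon2 Lf r alpha beta)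
                   (epsilon3 r2 alpha beta - eta * epsilon4 beta))
             (Rmin (epsilon5 Lf r2 alpha beta - eta * epsilon6 Lf r2 alpha beta) (/ 4)).
Definition epsilon8 (r2 alpha beta : R) : R := (alpha + beta) / (2 * beta) + / (2 * r2).

Definition algorithm1 (n p : nat) (L : 'I_n -> 'I_n -> R) (gs : 'I_n -> vec p -> vec p)
  (alpha beta eta : R) (x v : nat -> svec n p) : Prop :=
  (forall c, sumR (fun j => v 0%nat j c) = 0) /\
  (forall (k : nat) i c,
     x (S k) i c = x k i c - eta * (alpha * sumR (fun j => L i j * x k j c)
                                    + beta * v k i c + gs i (x k i) c)) /\
  (forall (k : nat) i c,
     v (S k) i c = v k i c + eta * beta * sumR (fun j => L i j * x k j c)).

Definition xbar (n p : nat) (x : nat -> svec n p) (k : nat) : vec p := savg (x k).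
Definition xbarS (n p : nat) (x : nat -> svec n p) (k : nat) : svec n p :=
  fun _ => xbar x k.
Definition gk (n p : nat) (gs : 'I_n -> vec p -> vec p) (x : nat -> svec n p) (k : nat)
  : svec n p := fun i => gs i (x k i).
Definition g0k (n p : nat) (gs : 'I_n -> vec p -> vec p) (x : nat -> svec n p) (k : nat)
  : svec n p := fun i => gs i (xbar x k).
Definition vshift (n p : nat) (gs : 'I_n -> vec p -> vec p) (beta : R)
  (x v : nat -> svec n p) (k : nat) : svec n p :=
  fun i c => v k i c + / beta * g0k gs x k i c.

Definition Vhat (n p : nat) (fs : 'I_n -> vec p -> R) (gs : 'I_n -> vec p -> vec p)
  (fstar beta : R) (x v : nat -> svec n p) (k : nat) : R :=
  Knormsq (x k) + Knormsq (vshift gs beta x v k)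
  + INR n * (fglob fs (xbar x k) - fstar).

Definition Wk (n p : nat) (gs : 'I_n -> vec p -> vec p) (beta : R)
  (x v : nat -> svec n p) (k : nat) : R :=
  snormsq (fun i => vsub (x k i) (xbarS x k i)) + Knormsq (vshift gs beta x v k)
  + snormsq (Hmul (gk gs x k)) + snormsq (Hmul (g0k gs x k)).

(* Main.v *)
(* Write X = K x_k, s = K (v_k + g^0_k / beta).  The Lyapunov function is
     V_k = |X|^2/2 + |s|^2_{L^+}/2 + (alpha / 2 beta) |s|^2 + <X, s> + n (f(xbar_k) - f^* ),
   with L^+ the pseudo-inverse of the Laplacian; the two first-order cross terms between
   X and s cancel in V_{k+1} - V_k, and the gradient drift g^0_{k+1} - g^0_k is at most
   L_f eta |Hg_k|, because xbar moves by -eta times the average gradient.  Young's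
   inequality then gives V_{k+1} <= V_k - epsilon_7 W_k, and
   n (f - f^* ) <= V <= epsilon_8 Vhat.
   L^+ is never built: |s|^2_{L^+} is <y, L y> for any y with L y = s, and
   y + eta beta X + z / beta, where L z = K (g^0_{k+1} - g^0_k), is such a y for s_{k+1}. *)

Require Import Defs.
From mathcomp Require Import ssreflect ssrfun ssrbool eqtype ssrnat seq fintype bigop.
From Stdlib Require Import Reals Relations Lra FunctionalExtensionality.
From mathcomp Require Import ssralg matrix Rstruct.

Local Open Scope R_scope.

(** * Finite sums of reals *)

Lemma sumR_ext {n} (F G : 'I_n -> R) : (forall i, F i = G i) -> sumR F = sumR G.
Proof. by move=> FG; apply: eq_bigr => i _; apply: FG. Qed.

Lemma sumRD {n} (F G : 'I_n -> R) : sumR (fun i => F i + G i) = sumR F + sumR G.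
Proof. exact: big_split. Qed.

Lemma sumRZ {n} (a : R) (F : 'I_n -> R) : sumR (fun i => a * F i) = a * sumR F.
Proof. by rewrite /sumR big_distrr. Qed.

Lemma sumRB {n} (F G : 'I_n -> R) : sumR (fun i => F i - G i) = sumR F - sumR G.
Proof.
rewrite (sumR_ext (fun i => F i - G i) (fun i => F i + -1 * G i)).
  by rewrite sumRD sumRZ; ring.
by move=> i; ring.
Qed.

Lemma sumR_const {n} (a : R) : sumR (fun _ : 'I_n => a) = INR n * a.
Proof.
rewrite /sumR big_const_ord; elim: n => [|n IH]; first by rewrite /=; ring.
by rewrite iterS IH S_INR; ring.
Qed.

Lemma sumR_exchange {n m} (F : 'I_n -> 'I_m -> R) :
  sumR (fun i => sumR (fun j => F i j)) = sumR (fun j => sumR (fun i => F i j)).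
Proof. exact: exchange_big. Qed.

Lemma sumR_le {n} (F G : 'I_n -> R) : (forall i, F i <= G i) -> sumR F <= sumR G.
Proof.
move=> FG; apply: (big_ind2 (fun a b => a <= b)) => [|a b c d|i _]; try lra.
exact: FG.
Qed.

Lemma sumR_ge0 {n} (F : 'I_n -> R) : (forall i, 0 <= F i) -> 0 <= sumR F.
Proof.
move=> F0; apply: (Rle_trans _ (sumR (fun _ : 'I_n => 0))); last exact: sumR_le.
by rewrite sumR_const; lra.
Qed.

Lemma sumRD1 {n} (i : 'I_n) (F : 'I_n -> R) :
  sumR F = F i + \big[Rplus/0]_(j < n | j != i) F j.
Proof. by rewrite /sumR (bigD1 i). Qed.

Lemma sumR_ge_term {n} (i : 'I_n) (F : 'I_n -> R) : (forall j, 0 <= F j) -> F i <= sumR F.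
Proof.
move=> F0; rewrite (sumRD1 i).
suff : 0 <= \big[Rplus/0]_(j < n | j != i) F j by lra.
by apply: big_ind => [|a b|j _]; [lra | lra | exact: F0].
Qed.

Lemma sumR_eq0 {n} (i : 'I_n) (F : 'I_n -> R) :
  (forall j, 0 <= F j) -> sumR F = 0 -> F i = 0.
Proof.
move=> F0 s0; have := sumR_ge_term i F F0; have := F0 i; rewrite s0; lra.
Qed.

Lemma sumR_delta {n} (i : 'I_n) (F : 'I_n -> R) :
  sumR (fun j => (if i == j then 1 else 0) * F j) = F i.
Proof.
rewrite (sumRD1 i) eqxx big1; first by ring.
by move=> j; rewrite eq_sym => /negbTE ->; ring.
Qed.

(** * Inner product and squared norm of vectors *)

Definition vlin {p} (a : R) (u : vec p) (b : R) (w : vec p) : vec p :=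
  fun c => a * u c + b * w c.

Lemma dotC {p} (u w : vec p) : dot u w = dot w u.
Proof. by apply: sumR_ext => c; ring. Qed.

Lemma dot_linl {p} a (u : vec p) b w t :
  dot (vlin a u b w) t = a * dot u t + b * dot w t.
Proof.
by rewrite /dot -!sumRZ -sumRD; apply: sumR_ext => c; rewrite /vlin; ring.
Qed.

Lemma dot_linr {p} a (u : vec p) b w t :
  dot t (vlin a u b w) = a * dot t u + b * dot t w.
Proof. by rewrite dotC dot_linl !(dotC t). Qed.

Lemma normsq_ge0 {p} (u : vec p) : 0 <= normsq u.
Proof. by apply: sumR_ge0 => c; have := Rle_0_sqr (u c); rewrite /Rsqr. Qed.

Lemma normsq_lin {p} a (u : vec p) b w :
  normsq (vlin a u b w) = a ^ 2 * normsq u + 2 * (a * b) * dot u w + b ^ 2 * normsq w.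
Proof. by rewrite /normsq dot_linl !dot_linr (dotC w u); ring. Qed.

Lemma normsq_eq0 {p} (u : vec p) : normsq u = 0 -> forall c, u c = 0.
Proof.
move=> u0 c.
have := sumR_eq0 c (fun c => u c * u c) (fun c => Rle_0_sqr (u c)) u0.
by case/Rmult_integral.
Qed.

(** * Square matrices as linear maps, and the least eigenvalue of a symmetric one *)

Definition mv {n} (M : 'I_n -> 'I_n -> R) (u : vec n) : vec n :=
  fun i => sumR (fun j => M i j * u j).

Definition symmetric {n} (M : 'I_n -> 'I_n -> R) := forall i j, M i j = M j i.

Lemma mv_lin {n} M a (u : vec n) b w : mv M (vlin a u b w) = vlin a (mv M u) b (mv M w).
Proof.
apply: functional_extensionality => i.
by rewrite /mv /vlin -!sumRZ -sumRD; apply: sumR_ext => j; ring.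
Qed.

Lemma mv_sym {n} M (u w : vec n) : symmetric M -> dot (mv M u) w = dot u (mv M w).
Proof.
move=> symM; rewrite /dot /mv.
transitivity (sumR (fun i => sumR (fun j => M i j * u j * w i))).
  by apply: sumR_ext => i; rewrite Rmult_comm -sumRZ; apply: sumR_ext => j; ring.
rewrite sumR_exchange; apply: sumR_ext => j; rewrite -sumRZ.
by apply: sumR_ext => i; rewrite (symM i j); ring.
Qed.

Lemma injective_mv_invertible {n} (M : 'I_n -> 'I_n -> R) :
  (forall u : vec n, (forall i, mv M u i = 0) -> forall i, u i = 0) ->
  exists N, forall u i, mv M (mv N u) i = u i.
Proof.
move=> injM; pose B : 'M[R]_n := (\matrix_(i, j) M i j)%R.
have uB : B \in unitmx.
  (* If [B] were singular, so would be its transpose, and [det0P] would give a nonzero row [w] with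
     [w *m B^T = 0], a kernel vector of [M]. *)
  rewrite unitmxE GRing.unitfE -det_tr; apply/negP => /det0P [w wn0 wB].
  case/negP: wn0; apply/eqP/rowP => j; rewrite mxE.
  apply: (injM (fun j => w ord0 j) _ j) => i.
  transitivity ((w *m B^T)%R ord0 i); last by rewrite wB mxE.
  rewrite mxE.
  by apply: eq_bigr => k _; rewrite !mxE Rmult_comm.
exists (fun i j => invmx B i j) => u i.
have <- : (B *m (invmx B *m (\col_j u j)))%R i ord0 = u i.
  by rewrite mulmxA mulmxV // mul1mx mxE.
rewrite mxE; apply: eq_bigr => j _; rewrite !mxE; congr (_ * _).
by apply: eq_bigr => k _; rewrite !mxE.
Qed.

(** Since |u_i u_j| <= |u|^2, the sum of the |M_ij| bounds the form of [M] and that of [- M]. Adding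
    1 makes the constant positive, hence invertible. *)
Lemma quad_form_bound {n} (M : 'I_n -> 'I_n -> R) :
  exists C, 0 < C /\ forall u : vec n, - (C * normsq u) <= dot u (mv M u) <= C * normsq u.
Proof.
pose C := sumR (fun i => sumR (fun j => Rabs (M i j))).
have C0 : 0 <= C by apply: sumR_ge0 => i; apply: sumR_ge0 => j; apply: Rabs_pos.
have up (M' : 'I_n -> 'I_n -> R) (u : vec n) :
    (forall i j, Rabs (M' i j) = Rabs (M i j)) -> dot u (mv M' u) <= C * normsq u.
  move=> absM; rewrite /C Rmult_comm -sumRZ; apply: sumR_le => i.
  rewrite -!sumRZ; apply: sumR_le => j; rewrite -absM.
  have ci : u i * u i <= normsq u.
    exact: (sumR_ge_term i (fun i => u i * u i) (fun i => Rle_0_sqr (u i))).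
  have cj : u j * u j <= normsq u.
    exact: (sumR_ge_term j (fun i => u i * u i) (fun i => Rle_0_sqr (u i))).
  have d1 := Rle_0_sqr (u i - u j); have d2 := Rle_0_sqr (u i + u j).
  rewrite /Rsqr in d1 d2; rewrite /Rabs; case: Rcase_abs => ?; nra.
exists (1 + C); split; first lra.
move=> u; have u0 := normsq_ge0 u.
have h1 := up M u (fun i j => erefl).
have := up (fun i j => - M i j) u (fun i j => Rabs_Ropp _).
have -> : mv (fun i j => - M i j) u = vlin (-1) (mv M u) 0 u.
  apply: functional_extensionality => i; rewrite /mv /vlin -sumRZ Rmult_0_l Rplus_0_r.
  by apply: sumR_ext => j; ring.
by rewrite dot_linr => h2; nra.
Qed.

(* The least eigenvalue is the supremum of the t with M - t I >= 0: if M - t I >= 0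
   were invertible at that supremum, it would be bounded below by a positive
   multiple of the identity. *)
Lemma min_eigenvalue {n} (M : 'I_n -> 'I_n -> R) :
  (0 < n)%nat -> symmetric M ->
  exists mu, is_eigenvalue M mu /\ forall u : vec n, mu * normsq u <= dot u (mv M u).
Proof.
move=> n0 symM.
have [C [C0 HC]] := quad_form_bound M.
pose S t := forall u : vec n, t * normsq u <= dot u (mv M u).
pose e : vec n := fun _ => 1.
have e0 : 0 < normsq e.
  rewrite /normsq /dot /e sumR_const; have := lt_0_INR n (ltP n0); lra.
have [mu [mu_ub mu_lub]] : {m | is_lub S m}.
  apply: completeness.
    exists C => t St; have := St e; have := HC e.
    by move=> ? ?; apply: (Rmult_le_reg_r (normsq e)); lra.
  by exists (- C) => u; have := HC u; lra.
have Smu : S mu.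
  (* For [u] nonzero, the Rayleigh quotient <u, M u> / |u|^2 is an upper bound of [S], hence at
     least [mu]; for [u] zero both sides vanish. *)
  move=> u; case: (Rle_lt_or_eq_dec _ _ (normsq_ge0 u)) => [u0|u0]; last first.
    rewrite -u0 Rmult_0_r /dot (sumR_ext _ (fun _ => 0)) ?sumR_const; first lra.
    by move=> i; rewrite (normsq_eq0 u) //; ring.
  apply: (Rmult_le_reg_r (/ normsq u)); first exact: Rinv_0_lt_compat.
  rewrite Rmult_assoc Rinv_r; last lra.
  rewrite Rmult_1_r; apply: mu_lub => t /(_ u) tu.
  apply: (Rmult_le_reg_r (normsq u)) => //.
  by rewrite Rmult_assoc Rinv_l; lra.
exists mu; split => //.
pose P i j := M i j - mu * (if i == j then 1 else 0).
have mvP u : mv P u = vlin 1 (mv M u) (- mu) u.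
  apply: functional_extensionality => i; rewrite /mv /vlin -(sumR_delta i u).
  by rewrite -!sumRZ -sumRD; apply: sumR_ext => j; rewrite /P; ring.
have symP : symmetric P by move=> i j; rewrite /P symM eq_sym.
case: (Classical_Prop.classic (is_eigenvalue M mu)) => // neig; exfalso.
have [N HN] : exists N, forall u i, mv P (mv N u) i = u i.
  apply: injective_mv_invertible => u Pu i.
  case: (Req_dec (u i) 0) => // ui; case: neig; exists u; split; first by exists i.
  by move=> j; have := Pu j; rewrite mvP /vlin /mv; lra.
have [D [D0 HD]] := quad_form_bound N.
suff /mu_ub : S (mu + / D) by have := Rinv_0_lt_compat _ D0; lra.
move=> u; pose y := mv N u.
have Py : mv P y = u by apply: functional_extensionality => i; apply: HN.
(* The form of [P] is nonnegative at u - y / D. As P y = u, this reads <u, P u> - 2 |u|^2 / D + <y,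
   u> / D^2 >= 0, and <y, u> <= D |u|^2 leaves <u, P u> >= |u|^2 / D. *)
have := Smu (vlin 1 u (- / D) y).
have H z : dot z (mv M z) - mu * normsq z = dot z (mv P z).
  by rewrite mvP dot_linr /normsq; ring.
move=> Hz; have {Hz} : 0 <= dot (vlin 1 u (- / D) y) (mv P (vlin 1 u (- / D) y)).
  by rewrite -H; lra.
rewrite mv_lin Py !dot_linl !dot_linr -(mv_sym P y u symP) Py -(H u) -/(normsq u) => Pge.
have := HD u; rewrite -/y (dotC u y) => uy.
have Di := Rinv_0_lt_compat _ D0.
have : / D * / D * dot y u <= / D * normsq u.
  apply: (Rle_trans _ (/ D * / D * (D * normsq u))); first by apply: Rmult_le_compat_l; nra.
  by right; field; lra.
lra.
Qed.

(** * Spectrum of the Laplacian *)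

Lemma normsq_pos {p} (u : vec p) c : u c <> 0 -> 0 < normsq u.
Proof.
move=> uc; case: (Rle_lt_or_eq_dec _ _ (normsq_ge0 u)) => // u0.
by case: uc; apply: normsq_eq0.
Qed.

Lemma mv_laplacian {n} A (u : vec n) i :
  mv (laplacian A) u i = sumR (fun j => A i j * (u i - u j)).
Proof.
transitivity (sumR (fun k => A i k) * u i - sumR (fun j => A i j * u j)).
  rewrite -(sumR_delta i (fun i => sumR (fun k => A i k) * u i)) -sumRB.
  by apply: sumR_ext => j; rewrite /laplacian; case: eqP => [->|_]; ring.
rewrite Rmult_comm -sumRZ -sumRB; apply: sumR_ext => j; ring.
Qed.

Lemma laplacian_sym {n} (A : 'I_n -> 'I_n -> R) : symmetric A -> symmetric (laplacian A).
Proof.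
by move=> symA i j; rewrite /laplacian eq_sym symA; case: eqP => [->|].
Qed.

(** Exchanging the two indices in the double sum of A_ij (u_i - u_j) changes its sign. *)
Lemma sumR_mv_laplacian {n} A (u : vec n) : symmetric A -> sumR (mv (laplacian A) u) = 0.
Proof.
move=> symA; have E : sumR (mv (laplacian A) u) = - sumR (mv (laplacian A) u).
  rewrite {1}(sumR_ext _ _ (mv_laplacian A u)) sumR_exchange.
  rewrite (sumR_ext (mv _ u) _ (mv_laplacian A u)) -[RHS]Rmult_1_l Ropp_mult_distr_r_reverse.
  rewrite Ropp_mult_distr_l -sumRZ; apply: sumR_ext => i; rewrite -sumRZ.
  by apply: sumR_ext => j; rewrite (symA j i); ring.
lra.
Qed.

(** Exchanging the indices gives a second expression of the form, with [- u j] in place of [u i];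
    the two add up to the sum of squares. *)
Lemma laplacian_form {n} A (u : vec n) : symmetric A ->
  dot u (mv (laplacian A) u)
  = / 2 * sumR (fun i => sumR (fun j => A i j * (u i - u j) ^ 2)).
Proof.
move=> symA.
have E1 : dot u (mv (laplacian A) u)
    = sumR (fun i => sumR (fun j => A i j * (u i - u j) * u i)).
  apply: sumR_ext => i; rewrite mv_laplacian -sumRZ; apply: sumR_ext => j; ring.
have E2 : dot u (mv (laplacian A) u)
    = sumR (fun i => sumR (fun j => A i j * (u i - u j) * - u j)).
  rewrite E1 sumR_exchange; apply: sumR_ext => i; apply: sumR_ext => j.
  by rewrite (symA j i); ring.
have -> : sumR (fun i => sumR (fun j => A i j * (u i - u j) ^ 2))
    = dot u (mv (laplacian A) u) + dot u (mv (laplacian A) u).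
  rewrite {1}E1 E2 -sumRD; apply: sumR_ext => i; rewrite -sumRD.
  by apply: sumR_ext => j; ring.
by field.
Qed.

Lemma laplacian_psd {n} A (u : vec n) :
  weighted_undirected A -> 0 <= dot u (mv (laplacian A) u).
Proof.
move=> [symA [A0 _]]; rewrite laplacian_form //; apply: Rmult_le_pos; first lra.
by apply: sumR_ge0 => i; apply: sumR_ge0 => j; apply: Rmult_le_pos (A0 i j) (pow2_ge_0 _).
Qed.

(** Every term of the sum of squares vanishes, so [u] agrees at the two ends of each edge, and then
    along every path. *)
Lemma laplacian_form_eq0 {n} A (u : vec n) :
  weighted_undirected A -> graph_connected A ->
  dot u (mv (laplacian A) u) = 0 -> forall i j, u i = u j.
Proof.
move=> [symA [A0 _]] conn; rewrite laplacian_form // => S0 i j.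
have term0 a b : 0 <= A a b * (u a - u b) ^ 2.
  exact: Rmult_le_pos (A0 a b) (pow2_ge_0 _).
elim: (conn i j) => [a b Aab|//|a b c _ -> _ ->//].
have /(sumR_eq0 b _ (term0 a)) : sumR (fun b => A a b * (u a - u b) ^ 2) = 0.
  apply: (sumR_eq0 a (fun a => sumR (fun b => A a b * (u a - u b) ^ 2))); last lra.
  by move=> k; apply: sumR_ge0.
by case/Rmult_integral => [|sq0]; [lra | nra].
Qed.

Section laplacian_spectrum.
Context {n : nat} {A : 'I_n -> 'I_n -> R}.
Context (wA : weighted_undirected A) (connA : graph_connected A).
Let L := laplacian A.

Lemma eigenvalue_dim M lam : @is_eigenvalue n M lam -> (0 < n)%nat.
Proof. by case=> w [[i _] _]; apply: leq_ltn_trans (ltn_ord i). Qed.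

(** [min_eigenvalue] applied to [- L]: the opposite of its least eigenvalue is an eigenvalue of
    [L]. *)
Lemma laplacian_upper rho (u : vec n) :
  is_largest_eigenvalue L rho -> dot u (mv L u) <= rho * normsq u.
Proof.
case: wA => symA _ [eig_rho rho_max].
have mvN w : mv (fun i j => - L i j) w = vlin (-1) (mv L w) 0 w.
  apply: functional_extensionality => i; rewrite /mv /vlin -sumRZ Rmult_0_l Rplus_0_r.
  by apply: sumR_ext => j; ring.
have [|mu [[w [wn0 Hw]] mu_min]] :=
  min_eigenvalue (fun i j => - L i j) (eigenvalue_dim _ _ eig_rho).
  by move=> i j; rewrite /L (laplacian_sym A symA).
have : - mu <= rho.
  apply: rho_max; exists w; split=> // i.
  have : mv (fun i j => - L i j) w i = mu * w i by exact: Hw.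
  by rewrite mvN /vlin /mv; lra.
have := mu_min u; rewrite mvN dot_linr; have := normsq_ge0 u; nra.
Qed.

Context {rho2 : R} (Hrho2 : is_smallest_pos_eigenvalue L rho2).

(* [L + (rho2 / n) 1 1^T] has least eigenvalue at least [rho2]: it moves the eigenvalue 0
   of L, whose eigenvectors are the constant ones, to [rho2]. *)
Lemma laplacian_lower (u : vec n) :
  rho2 * normsq u <= dot u (mv L u) + rho2 / INR n * (sumR u) ^ 2.
Proof.
case: Hrho2 => eig2 [rho2_gt0 rho2_min]; have n0 := eigenvalue_dim _ _ eig2.
have nR := lt_0_INR n (ltP n0); have [symA _] := wA.
pose M i j := L i j + rho2 / INR n.
have mvM w i : mv M w i = mv L w i + rho2 / INR n * sumR w.
  by rewrite /mv -sumRZ -sumRD; apply: sumR_ext => j; rewrite /M; ring.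
have [|mu [[w [[i0 wi0] Hw]] mu_min]] := min_eigenvalue M n0.
  by move=> i j; rewrite /M /L (laplacian_sym A symA).
have {}Hw i : mv L w i + rho2 / INR n * sumR w = mu * w i by rewrite -mvM; exact: Hw.
have uMu : dot u (mv M u) = dot u (mv L u) + rho2 / INR n * (sumR u) ^ 2.
  transitivity (dot u (mv L u) + sumR (fun i => rho2 / INR n * sumR u * u i)); last first.
    by rewrite sumRZ; ring.
  by rewrite /dot -sumRD; apply: sumR_ext => i; rewrite mvM; ring.
suff rho2_mu : rho2 <= mu.
  by have := mu_min u; have := normsq_ge0 u; rewrite uMu; nra.
(* Summing the eigenvector equation over the coordinates removes [L]. Hence either mu = rho2, or [w]
   has sum 0 and is an eigenvector of [L] itself. *)
have sum_w : rho2 * sumR w = mu * sumR w.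
  rewrite -(sumRZ mu) -(sumR_ext _ _ Hw) sumRD sumR_mv_laplacian // sumR_const.
  by field; lra.
case: (Req_dec mu rho2) => [->|mu2]; first lra.
have w0 : sumR w = 0 by apply: (Rmult_eq_reg_l (mu - rho2)); lra.
have {}Hw i : mv L w i = mu * w i by rewrite -Hw w0; ring.
have wLw : dot w (mv L w) = mu * normsq w.
  by rewrite /normsq /dot -sumRZ; apply: sumR_ext => i; rewrite Hw; ring.
have w_gt0 := normsq_pos w i0 wi0; have := laplacian_psd A w wA; rewrite -/L wLw => mu_ge0.
apply: rho2_min; first by exists w; split; [exists i0 | exact: Hw].
(* Semidefiniteness excludes mu < 0. If mu = 0, then [w] is constant with sum 0, so it vanishes. *)
case: (Rtotal_order mu 0) => [|[mu0|//]]; first nra.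
case: wi0; have : INR n * w i0 = 0; last by case/Rmult_integral; lra.
rewrite -sumR_const -w0; apply: sumR_ext => i.
by apply: (laplacian_form_eq0 A) => //; rewrite -/L wLw mu0; ring.
Qed.

(** The perturbed matrix L + (rho2 / n) 1 1^T is injective by [laplacian_lower], hence invertible.
    It multiplies coordinate sums by [rho2], so the preimage of [w] has sum 0 and the rank-one term
    disappears on it. *)
Lemma laplacian_range (w : vec n) : sumR w = 0 -> exists y, mv L y = w.
Proof.
move=> w0; case: Hrho2 => eig2 [rho2_gt0 rho2_min]; have n0 := eigenvalue_dim _ _ eig2.
have nR := lt_0_INR n (ltP n0); have [symA _] := wA.
pose M i j := L i j + rho2 / INR n.
have mvM u i : mv M u i = mv L u i + rho2 / INR n * sumR u.
  by rewrite /mv -sumRZ -sumRD; apply: sumR_ext => j; rewrite /M; ring.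
have sumM u : sumR (mv M u) = rho2 * sumR u.
  rewrite (sumR_ext _ _ (mvM u)) sumRD sumR_mv_laplacian // sumR_const.
  by field; lra.
have [N HN] : exists N, forall u i, mv M (mv N u) i = u i.
  apply: injective_mv_invertible => u Mu; apply: normsq_eq0.
  have u0 : sumR u = 0.
    have := sumM u; rewrite (sumR_ext _ _ Mu) sumR_const; nra.
  have := laplacian_lower u; have -> : dot u (mv L u) = 0.
    rewrite /dot (sumR_ext _ (fun _ => 0)) ?sumR_const; first by ring.
    by move=> i; have := Mu i; rewrite mvM u0 => E; nra.
  by rewrite u0; have := normsq_ge0 u; nra.
exists (mv N w); apply: functional_extensionality => i.
have y0 : sumR (mv N w) = 0.
  have := sumM (mv N w); rewrite (sumR_ext _ _ (HN w)) w0; nra.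
by have := HN w i; rewrite mvM y0; lra.
Qed.

End laplacian_spectrum.

(** * Stacked vectors *)

Section stacks.
Context {n p : nat}.
Implicit Types z w t : svec n p.

Definition ip z w : R := sumR (fun i => dot (z i) (w i)).
Definition slin (a : R) z (b : R) w : svec n p := fun i => vlin a (z i) b (w i).
(** The Kronecker product of [M] with I_p, applied to [z]. *)
Definition smul (M : 'I_n -> 'I_n -> R) z : svec n p :=
  fun i c => mv M (fun j => z j c) i.
(** This is K z; the stacks that K fixes are the [balanced] ones. *)
Definition center z : svec n p := fun i => vsub (z i) (savg z).
Definition balanced z := forall c, sumR (fun i => z i c) = 0.

Lemma svec_ext z w : (forall i c, z i c = w i c) -> z = w.
Proof.
by move=> zw; apply: functional_extensionality => i; apply: functional_extensionality.
Qed.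

Lemma ipC z w : ip z w = ip w z.
Proof. by apply: sumR_ext => i; apply: dotC. Qed.

Lemma ipxx z : ip z z = snormsq z.
Proof. by []. Qed.

Lemma ip_linl a z b w t : ip (slin a z b w) t = a * ip z t + b * ip w t.
Proof. by rewrite /ip -!sumRZ -sumRD; apply: sumR_ext => i; rewrite dot_linl. Qed.

Lemma ip_linr a z b w t : ip t (slin a z b w) = a * ip t z + b * ip t w.
Proof. by rewrite ipC ip_linl !(ipC t). Qed.

Lemma snormsq_ge0 z : 0 <= snormsq z.
Proof. by apply: sumR_ge0 => i; apply: normsq_ge0. Qed.

Lemma snormsq_lin a z b w :
  snormsq (slin a z b w) = a ^ 2 * snormsq z + 2 * (a * b) * ip z w + b ^ 2 * snormsq w.
Proof.
by rewrite -!ipxx ip_linl !ip_linr (ipC w z); ring.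
Qed.

(** Summing column by column reduces facts about stacks to the scalar Laplacian. *)
Lemma ip_col z w : ip z w = sumR (fun c => dot (fun i => z i c) (fun i => w i c)).
Proof. exact: sumR_exchange. Qed.

Lemma smul_lin M a z b w : smul M (slin a z b w) = slin a (smul M z) b (smul M w).
Proof.
apply: svec_ext => i c; exact: (congr1 (fun u => u i) (mv_lin M a (z^~ c) b (w^~ c))).
Qed.

Lemma smul_sym M z w : symmetric M -> ip (smul M z) w = ip z (smul M w).
Proof. by move=> symM; rewrite !ip_col; apply: sumR_ext => c; apply: mv_sym. Qed.

Lemma savg_lin a z b w : savg (slin a z b w) = vlin a (savg z) b (savg w).
Proof.
by apply: functional_extensionality => c; rewrite /savg /vlin /slin /vlin sumRD !sumRZ; ring.
Qed.

Lemma center_lin a z b w : center (slin a z b w) = slin a (center z) b (center w).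
Proof.
by apply: svec_ext => i c; rewrite /center savg_lin /slin /vsub /vlin; ring.
Qed.

Lemma savg_balanced z c : balanced z -> savg z c = 0.
Proof. by move=> bz; rewrite /savg bz; ring. Qed.

Lemma center_balanced z : balanced z -> center z = z.
Proof. by move=> bz; apply: svec_ext => i c; rewrite /center /vsub savg_balanced //; ring. Qed.

Context (n_gt0 : (0 < n)%nat).
Let nR : 0 < INR n := lt_0_INR n (ltP n_gt0).

Lemma sum_savg z c : sumR (fun i => z i c) = INR n * savg z c.
Proof. by rewrite /savg; field; lra. Qed.

Lemma balanced_center z : balanced (center z).
Proof. by move=> c; rewrite /center /vsub sumRB sumR_const sum_savg; ring. Qed.

Lemma snormsq_Hmul z : snormsq (Hmul z) = INR n * normsq (savg z).
Proof. by rewrite /snormsq /Hmul sumR_const. Qed.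

(** K and H are complementary orthogonal projections. *)
Lemma snormsq_pythagoras z : snormsq z = snormsq (center z) + snormsq (Hmul z).
Proof.
have -> : snormsq z = snormsq (slin 1 (center z) 1 (Hmul z)).
  by congr snormsq; apply: svec_ext => i c; rewrite /slin /vlin /center /vsub /Hmul; ring.
rewrite snormsq_lin.
have -> : ip (center z) (Hmul z) = 0; last by ring.
rewrite ip_col (sumR_ext _ (fun _ => 0)) ?sumR_const; first by ring.
move=> c; rewrite dotC; transitivity (sumR (fun i => savg z c * center z i c)) => //.
by rewrite sumRZ balanced_center; ring.
Qed.

(** K is an orthogonal projection, so z^T K z = |K z|^2. *)
Lemma Knormsq_center z : Knormsq z = snormsq (center z).
Proof.
have -> : snormsq (center z) = snormsq z - snormsq (Hmul z).
  by have := snormsq_pythagoras z; lra.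
rewrite snormsq_Hmul /Knormsq; congr (_ - _).
rewrite /normsq /dot (sumR_ext _ (fun c => INR n * INR n * (savg z c * savg z c))).
  by rewrite sumRZ; field; lra.
by move=> c; rewrite sum_savg; ring.
Qed.

Lemma snormsq_center_le z : snormsq (center z) <= snormsq z.
Proof. by have := snormsq_pythagoras z; have := snormsq_ge0 (Hmul z); lra. Qed.

Lemma snormsq_Hmul_le z : snormsq (Hmul z) <= snormsq z.
Proof. by have := snormsq_pythagoras z; have := snormsq_ge0 (center z); lra. Qed.

(** * The Laplacian acting on stacked vectors *)

Section laplacian.
Context {A : 'I_n -> 'I_n -> R}.
Context (wA : weighted_undirected A) (connA : graph_connected A).
Let L := laplacian A.
Let symA : symmetric A. Proof. by case: wA. Qed.
Let symL : symmetric L := laplacian_sym A symA.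

Lemma balanced_smul z : balanced (smul L z).
Proof. by move=> c; apply: sumR_mv_laplacian. Qed.

Lemma smul_center z : smul L (center z) = smul L z.
Proof.
apply: svec_ext => i c; rewrite /smul !mv_laplacian; apply: sumR_ext => j.
by rewrite /center /vsub; ring.
Qed.

Lemma smul_psd z : 0 <= ip z (smul L z).
Proof. by rewrite ip_col; apply: sumR_ge0 => c; apply: laplacian_psd. Qed.

(** Young's inequality for the semidefinite form of [L], from its value at a z - b w. *)
Lemma smul_young a z b w :
  2 * (a * b) * ip z (smul L w) <= a ^ 2 * ip z (smul L z) + b ^ 2 * ip w (smul L w).
Proof.
have := smul_psd (slin a z (- b) w).
rewrite smul_lin ip_linl !ip_linr -(smul_sym L w z) // (ipC (smul L w) z); lra.
Qed.

Context {rho rho2 : R}.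
Context (Hrho : is_largest_eigenvalue L rho) (Hrho2 : is_smallest_pos_eigenvalue L rho2).

Lemma rho2_gt0 : 0 < rho2. Proof. by case: Hrho2 => _ []. Qed.

Lemma rho2_le_rho : rho2 <= rho.
Proof. by case: Hrho => _; apply; case: Hrho2. Qed.

Lemma smul_upper z : ip z (smul L z) <= rho * snormsq z.
Proof.
rewrite -ipxx !ip_col -sumRZ; apply: sumR_le => c.
exact: (laplacian_upper wA rho (z^~ c)).
Qed.

Lemma smul_lower z : balanced z -> rho2 * snormsq z <= ip z (smul L z).
Proof.
move=> bz; rewrite -ipxx !ip_col -sumRZ; apply: sumR_le => c.
have := laplacian_lower wA connA Hrho2 (z^~ c); rewrite bz.
by rewrite pow_i; [rewrite Rmult_0_r Rplus_0_r | apply/ltP].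
Qed.

Lemma smul_range w : balanced w -> exists z, smul L z = w.
Proof.
move=> bw.
(* One preimage per column; the index type being finite, they can be collected into a function. *)
have /fin_all_exists [y Hy] c : exists y, mv L y = w^~ c.
  exact: (laplacian_range wA connA Hrho2).
exists (fun i c => y c i); apply: svec_ext => i c.
exact: (congr1 (fun u => u i) (Hy c)).
Qed.

(** [smul_young] with w = L z gives 2 rho |L z|^2 <= rho^2 <z, L z> + <L z, L L z>. The last term is
    at most rho |L z|^2, so |L z|^2 <= rho <z, L z>, and [smul_upper] applies again. *)
Lemma snormsq_smul_le z : snormsq (smul L z) <= rho ^ 2 * snormsq z.
Proof.
have r0 := rho2_gt0; have r1 := rho2_le_rho.
have := smul_young rho z 1 (smul L z).
have := smul_upper (smul L z); have := smul_upper z.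
rewrite -(smul_sym L z (smul L z)) // ipxx => u1 u2 y.
apply: (Rle_trans _ (rho * ip z (smul L z))); last by nra.
by apply: (Rmult_le_reg_l rho); lra.
Qed.

(** For s = L z this is |s|^2_{L^+} <= |s|^2 / rho2. Expand |L z - rho2 K z|^2 >= 0 and use rho2 |K
    z|^2 <= <z, L z>. *)
Lemma smul_inverse_bound z : rho2 * ip z (smul L z) <= snormsq (smul L z).
Proof.
have := smul_lower (center z) (balanced_center z); rewrite smul_center.
have -> : ip (center z) (smul L z) = ip z (smul L z).
  by rewrite -(smul_sym L (center z) z) // smul_center smul_sym.
have := snormsq_ge0 (slin 1 (smul L z) (- rho2) (center z)); rewrite snormsq_lin.
have -> : ip (smul L z) (center z) = ip z (smul L z).
  by rewrite smul_sym // smul_center.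
have := rho2_gt0; nra.
Qed.

End laplacian.
End stacks.

(** * The Lyapunov function *)

(* [y] stands for a preimage of the paper's v + g^0 / beta, projected by K. *)
Definition lyapunov {n p} (M : 'I_n -> 'I_n -> R) (alpha beta : R) (x y : svec n p) : R :=
  / 2 * snormsq x + / 2 * ip y (smul M y) + alpha / (2 * beta) * snormsq (smul M y)
  + ip x (smul M y).

(** An exact expansion. At first order in [eta], [ip x s] cancels between the first two terms of
    [lyapunov], and [ip l s] between the last two; this is what fixes the weight alpha / (2
    beta). *)
Lemma lyapunov_increment {n p} (M : 'I_n -> 'I_n -> R) (alpha beta eta : R)
    (x y z h : svec n p) (l := smul M x) (s := smul M y) (d := smul M z)
    (x' := slin 1 x (- eta) (slin 1 (slin alpha l beta s) 1 h))
    (y' := slin 1 (slin 1 y (eta * beta) x) (/ beta) z) :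
  symmetric M -> 0 < beta ->
  lyapunov M alpha beta x' y' = lyapunov M alpha beta x y
    + eta * (- (alpha - beta) * ip x l - ip x h - beta * snormsq s - ip s h)
    + / beta * (ip y d + alpha * / beta * ip s d + ip x d)
    + eta ^ 2 * (alpha * (alpha - beta) / 2 * snormsq l + beta ^ 2 / 2 * snormsq s
                 + / 2 * snormsq h + beta * (alpha - beta) * ip l s
                 + (alpha - beta) * ip l h + beta * ip s h + beta ^ 2 / 2 * ip x l)
    + eta * (ip x d - ip s d - / beta * ip h d)
    + / beta ^ 2 * (/ 2 * ip z d + alpha / (2 * beta) * snormsq d).
Proof.
move=> symM b0; rewrite /lyapunov.
have -> : smul M y' = slin 1 (slin 1 s (eta * beta) l) (/ beta) d by rewrite !smul_lin.
rewrite -/s /x' /y' -!ipxx !ip_linl !ip_linr.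
rewrite (ipC l x) (ipC s x) (ipC h x) (ipC s l) (ipC h l) (ipC h s) (ipC d s) (ipC d l).
have -> : ip y l = ip x s by rewrite -(smul_sym M y x) // ipC.
have -> : ip z s = ip y d by rewrite -(smul_sym M z y) // ipC.
have -> : ip z l = ip x d by rewrite -(smul_sym M z x) // ipC.
by field; lra.
Qed.

Section lyapunov_step.
Context {n p : nat} {A : 'I_n -> 'I_n -> R} {rho rho2 : R}.
Context (n_gt0 : (0 < n)%nat) (wA : weighted_undirected A) (connA : graph_connected A).
Let L := laplacian A.
Context (Hrho : is_largest_eigenvalue L rho) (Hrho2 : is_smallest_pos_eigenvalue L rho2).
Let symL : symmetric L. Proof. by apply: laplacian_sym; case: wA. Qed.

Lemma young a (z : svec n p) b w :
  2 * (a * b) * ip z w <= a ^ 2 * snormsq z + b ^ 2 * snormsq w.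
Proof.
have := snormsq_ge0 (slin a z (- b) w); rewrite snormsq_lin; lra.
Qed.

(** The surplus Lf^2 / 2 beside [epsilon1] pays for the gradient error in [global_descent]. The 1 /
    eta before |d|^2 is harmless because [d] will be the gradient drift, of order [eta]. *)
Lemma lyapunov_step (alpha beta eta Lf : R) (x y z h : svec n p)
    (s := smul L y) (d := smul L z)
    (x' := slin 1 x (- eta) (slin 1 (slin alpha (smul L x) beta s) 1 h))
    (y' := slin 1 (slin 1 y (eta * beta) x) (/ beta) z) :
  0 < beta -> beta < alpha -> 0 < eta -> balanced x ->
  snormsq h <= Lf ^ 2 * snormsq x ->
  lyapunov L alpha beta x' y' <= lyapunov L alpha beta x y
    - eta * (epsilon1 Lf rho2 alpha beta + Lf ^ 2 / 2 - eta * epsilon2 Lf rho alpha beta)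
      * snormsq x
    - eta * (epsilon3 rho2 alpha beta - eta * epsilon4 beta) * snormsq s
    + (/ (2 * beta) * (/ beta + / rho2 + alpha / beta) / eta
       + / beta ^ 2 * (1 + / rho2 + alpha / beta)) * snormsq d.
Proof.
move=> b0 ab e0 bx hx; rewrite (lyapunov_increment L alpha beta eta x y z h symL b0).
rewrite -/s -/d; set l := smul L x.
have r2 := rho2_gt0 Hrho2.
have bi := Rinv_0_lt_compat _ b0; have ei := Rinv_0_lt_compat _ e0.
have ri := Rinv_0_lt_compat _ r2.
have xx := snormsq_ge0 x; have ss := snormsq_ge0 s; have dd := snormsq_ge0 d.
have xl_le : ip x l <= rho * snormsq x by exact: (smul_upper wA Hrho x).
have xl_ge : rho2 * snormsq x <= ip x l by exact: (smul_lower wA connA Hrho2).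
have ll : snormsq l <= rho ^ 2 * snormsq x by exact: (snormsq_smul_le wA Hrho Hrho2).
have ys : ip y s <= / rho2 * snormsq s.
  apply: (Rmult_le_reg_l rho2) => //; rewrite -Rmult_assoc Rinv_r; last lra.
  by rewrite Rmult_1_l; apply: (smul_inverse_bound n_gt0 wA connA Hrho2).
have zd : ip z d <= / rho2 * snormsq d.
  apply: (Rmult_le_reg_l rho2) => //; rewrite -Rmult_assoc Rinv_r; last lra.
  by rewrite Rmult_1_l; apply: (smul_inverse_bound n_gt0 wA connA Hrho2).
have hh := snormsq_ge0 h.
set b := / beta in bi *; set r := / rho2 in ri ys zd *; set t := / eta in ei *.
have bb : beta * b = 1 by rewrite /b; field; lra.
have et : eta * t = 1 by rewrite /t; field; lra.
have e2 : 0 < eta ^ 2 by apply: pow_lt.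
have b2 : 0 < b ^ 2 by apply: pow_lt.
(* Young's inequality is applied below with weight [eta] on [y], [s] or [x]; dividing by 2 eta
   leaves [eta] on the state and [t = / eta] on [d]. *)
have half (a c : R) : 2 * eta * a <= eta ^ 2 * c -> a <= / 2 * (eta * c).
  by move=> ac; apply: (Rmult_le_reg_l (2 * eta)); nra.
(* Each of the two products with [h] costs |h|^2 / 2, hence Lf^2 |x|^2 in all. *)
have first_order : - (alpha - beta) * ip x l - ip x h - beta * snormsq s - ip s h
    <= (/ 2 + Lf ^ 2 - (alpha - beta) * rho2) * snormsq x + (/ 2 - beta) * snormsq s.
  have := young 1 x (-1) h; have := young 1 s (-1) h.
  have := Rmult_le_compat_l (alpha - beta) _ _ (ltac:(lra)) xl_ge; lra.
have yd : ip y d <= / 2 * (eta * (r * snormsq s + t ^ 2 * (r * snormsq d))).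
  apply: half; have := smul_young wA eta y 1 z; rewrite -/L -/s -/d.
  have := Rmult_le_compat_l _ _ _ (Rlt_le _ _ e2) ys.
  have -> : eta ^ 2 * (r * snormsq s + t ^ 2 * (r * snormsq d))
    = eta ^ 2 * (r * snormsq s) + (eta * t) ^ 2 * (r * snormsq d) by ring.
  rewrite et; lra.
have sd : ip s d <= / 2 * (eta * (snormsq s + t ^ 2 * snormsq d)).
  apply: half; have := young eta s 1 d.
  have -> : eta ^ 2 * (snormsq s + t ^ 2 * snormsq d)
    = eta ^ 2 * snormsq s + (eta * t) ^ 2 * snormsq d by ring.
  rewrite et; lra.
have xd : b * ip x d <= / 2 * (eta * (snormsq x + t ^ 2 * (b ^ 2 * snormsq d))).
  apply: half; have := young eta x b d.
  have -> : eta ^ 2 * (snormsq x + t ^ 2 * (b ^ 2 * snormsq d))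
    = eta ^ 2 * snormsq x + (eta * t) ^ 2 * (b ^ 2 * snormsq d) by ring.
  rewrite et; lra.
have coupling : b * (ip y d + alpha * b * ip s d + ip x d)
    <= / 2 * eta * (snormsq x + (b * r + alpha * b ^ 2) * snormsq s)
       + / 2 * t * (b * (b + r + alpha * b)) * snormsq d.
  have := Rmult_le_compat_l b _ _ (Rlt_le _ _ bi) yd.
  have := Rmult_le_compat_l (alpha * b ^ 2) _ _ (ltac:(nra)) sd.
  have E c : / 2 * (eta * (c * t ^ 2)) = / 2 * t * c.
    by transitivity (/ 2 * (eta * t) * t * c); [ring | rewrite et; ring].
  have := E (b * (r * snormsq d)); have := E (alpha * b ^ 2 * snormsq d).
  have := E (b ^ 2 * snormsq d); lra.
have second_order :
    alpha * (alpha - beta) / 2 * snormsq l + beta ^ 2 / 2 * snormsq s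
      + / 2 * snormsq h + beta * (alpha - beta) * ip l s
      + (alpha - beta) * ip l h + beta * ip s h + beta ^ 2 / 2 * ip x l
    <= 2 * alpha ^ 2 * snormsq l + 3 / 2 * beta ^ 2 * snormsq s + 3 / 2 * snormsq h
       + beta ^ 2 / 2 * ip x l.
  have := young (alpha - beta) l beta s; have := young (alpha - beta) l 1 h.
  have := young beta s 1 h.
  (* The coefficient is 2 alpha^2 minus alpha (alpha - beta) / 2 + (alpha - beta)^2, which is
     nonnegative as alpha > beta > 0. *)
  have : 0 <= (alpha ^ 2 / 2 + 5 / 2 * alpha * beta - beta ^ 2) * snormsq l.
    by apply: Rmult_le_pos (snormsq_ge0 l); nra.
  lra.
(* The weights eta beta and 1 / beta have product [eta], so the [d] terms carry no inverse of
   [eta]. *)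
have cross : eta * (ip x d - ip s d - b * ip h d)
    <= eta ^ 2 / 2 * (beta ^ 2 * ip x l + beta ^ 2 * snormsq s + snormsq h)
       + b ^ 2 / 2 * (ip z d + 2 * snormsq d).
  have := smul_young wA (eta * beta) x b z; have := young (eta * beta) s (- b) d.
  have := young eta h (- b) d; rewrite -/L -/d -/l.
  have -> : eta * beta * b = eta by rewrite Rmult_assoc bb; ring.
  have -> : eta * beta * - b = - eta.
    by rewrite Ropp_mult_distr_r_reverse Rmult_assoc bb; ring.
  lra.
have quad : eta ^ 2 * (2 * alpha ^ 2 * snormsq l + 2 * beta ^ 2 * snormsq s
                       + 2 * snormsq h + beta ^ 2 * ip x l)
    <= eta ^ 2 * (epsilon2 Lf rho alpha beta * snormsq x + epsilon4 beta * snormsq s).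
  apply: Rmult_le_compat_l; first lra.
  rewrite /epsilon2 /epsilon4.
  have := Rmult_le_compat_l (2 * alpha ^ 2) _ _ (ltac:(nra)) ll.
  have := Rmult_le_compat_l (beta ^ 2) _ _ (ltac:(nra)) xl_le.
  have : 0 <= beta ^ 2 * rho ^ 2 * snormsq x.
    by apply: Rmult_le_pos => //; apply: Rmult_le_pos; apply: pow2_ge_0.
  have : 0 <= Lf ^ 2 * snormsq x by apply: Rmult_le_pos => //; apply: pow2_ge_0.
  lra.
have zd' := Rmult_le_compat_l (b ^ 2) _ _ (Rlt_le _ _ b2) zd.
(* Half of this separates the weight alpha / (2 beta) of |d|^2 in the expansion from the alpha /
   beta of the statement. *)
have slack : 0 <= b ^ 2 * (alpha * b) * snormsq d.
  by apply: Rmult_le_pos => //; apply: Rmult_le_pos; nra.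
have {}first_order := Rmult_le_compat_l eta _ _ (Rlt_le _ _ e0) first_order.
have {}second_order := Rmult_le_compat_l (eta ^ 2) _ _ (Rlt_le _ _ e2) second_order.
have -> : epsilon1 Lf rho2 alpha beta = (alpha - beta) * rho2 - 1 - 3 / 2 * Lf ^ 2.
  by rewrite /epsilon1; field.
have -> : epsilon3 rho2 alpha beta = beta - / 2 - alpha * b ^ 2 / 2 - b * r / 2.
  by rewrite /epsilon3 /b /r; field; lra.
have -> : / beta ^ 2 = b ^ 2 by rewrite /b; field; lra.
have -> : / (2 * beta) * (b + r + alpha / beta) / eta = / 2 * t * (b * (b + r + alpha * b)).
  by rewrite /b /r /t; field; lra.
have -> : alpha / (2 * beta) = alpha * b / 2 by rewrite /b; field; lra.
have -> : alpha / beta = alpha * b by [].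
lra.
Qed.
End lyapunov_step.

(** * The descent lemma for functions with Lipschitz gradient *)

Definition vscale {p} (t : R) (h : vec p) : vec p := fun c => t * h c.

Lemma dot_scale {p} (u : vec p) t h : dot u (vscale t h) = t * dot u h.
Proof. by rewrite /dot -sumRZ; apply: sumR_ext => c; rewrite /vscale; ring. Qed.

Lemma normsq_scale {p} t (h : vec p) : normsq (vscale t h) = t ^ 2 * normsq h.
Proof. by rewrite /normsq dot_scale dotC dot_scale; ring. Qed.

Lemma norm_scale {p} t (h : vec p) : norm (vscale t h) = Rabs t * norm h.
Proof.
have -> : norm (vscale t h) = sqrt (Rsqr t * normsq h).
  by rewrite /norm normsq_scale /Rsqr; congr sqrt; ring.
rewrite sqrt_mult; [|exact: Rle_0_sqr|exact: normsq_ge0].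
by rewrite sqrt_Rsqr_abs.
Qed.

Lemma derivable_along_line {p} (f : vec p -> R) g (x h : vec p) t :
  is_gradient f g ->
  derivable_pt_lim (fun t => f (vadd x (vscale t h))) t
    (dot (g (vadd x (vscale t h))) h).
Proof.
move=> fg eps eps0; have nh : 0 <= norm h := sqrt_pos _.
have nh1 : 0 < / (norm h + 1) by apply: Rinv_0_lt_compat; lra.
(* Dividing by norm h + 1 instead of norm h covers h = 0 as well. *)
have nhi : norm h * / (norm h + 1) < 1.
  by apply: (Rmult_lt_reg_r (norm h + 1)); [lra | rewrite Rmult_assoc Rinv_l; lra].
have [|delta [delta0 Hd]] := fg (vadd x (vscale t h)) (eps * / (norm h + 1)).
  exact: Rmult_lt_0_compat.
have d0 : 0 < delta * / (norm h + 1) by apply: Rmult_lt_0_compat.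
exists (mkposreal _ d0) => s s0 /= sd; have as0 := Rabs_pos_lt _ s0.
have := Hd (vscale s h); rewrite norm_scale dot_scale => H.
have {H} H := H (ltac:(nra)).
have -> : vadd x (vscale (t + s) h) = vadd (vadd x (vscale t h)) (vscale s h).
  by apply: functional_extensionality => c; rewrite /vadd /vscale; ring.
set a := f _ in H *; set b := f _ in H *; set D := dot _ _ in H *.
have -> : (a - b) / s - D = (a - b - s * D) * / s by field.
rewrite Rabs_mult Rabs_inv; apply: (Rmult_lt_reg_r (Rabs s)) => //.
rewrite Rmult_assoc Rinv_l; last lra.
rewrite Rmult_1_r; apply: Rle_lt_trans H _.
have : 0 < eps * Rabs s by apply: Rmult_lt_0_compat.
nra.
Qed.

(** The mean value theorem replaces integration: [psi], which is f along the segment minus t <g x,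
    h> + (Lf / 2) t^2 |h|^2, has nonpositive derivative inside [0, 1]. *)
Lemma descent {p} (f : vec p -> R) g Lf (x h : vec p) :
  0 < Lf -> is_gradient f g ->
  (forall y z, normsq (vsub (g y) (g z)) <= Lf ^ 2 * normsq (vsub y z)) ->
  f (vadd x h) <= f x + dot (g x) h + Lf / 2 * normsq h.
Proof.
move=> L0 fg lip; pose phi t := f (vadd x (vscale t h)).
pose psi := (phi - (mult_real_fct (dot (g x) h) id + mult_real_fct (Lf / 2 * normsq h) Rsqr))%F.
pose dpsi t := dot (g (vadd x (vscale t h))) h
  - (dot (g x) h * 1 + Lf / 2 * normsq h * (2 * t)).
have [c _|c [psi_eq [c0 c1]]] := MVT_cor2 psi dpsi 0 1 Rlt_0_1.
  apply: derivable_pt_lim_minus; first exact: derivable_along_line.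
  apply: derivable_pt_lim_plus; apply: derivable_pt_lim_scal.
    exact: derivable_pt_lim_id.
  exact: derivable_pt_lim_Rsqr.
have phi1 : phi 1 = f (vadd x h).
  by congr f; apply: functional_extensionality => i; rewrite /vadd /vscale; ring.
have phi0 : phi 0 = f x.
  by congr f; apply: functional_extensionality => i; rewrite /vadd /vscale; ring.
suff : dpsi c <= 0.
  move: psi_eq; rewrite /psi /minus_fct /plus_fct /mult_real_fct /id /Rsqr phi0 phi1; lra.
have := lip (vadd x (vscale c h)) x.
have -> : vsub (vadd x (vscale c h)) x = vscale c h.
  by apply: functional_extensionality => i; rewrite /vsub /vadd /vscale; ring.
rewrite normsq_scale; set w := vsub _ _ => lipw.
have -> : dpsi c = dot w h - Lf * c * normsq h.
  have -> : w = vlin 1 (g (vadd x (vscale c h))) (-1) (g x).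
    by apply: functional_extensionality => i; rewrite /w /vsub /vlin; ring.
  by rewrite dot_linl /dpsi; field.
(* The square |w - Lf c h|^2 >= 0, with |w|^2 <= Lf^2 c^2 |h|^2, gives <w, h> <= Lf c |h|^2. *)
have := normsq_ge0 (vlin 1 w (- (Lf * c)) h); rewrite normsq_lin => sq.
by apply: (Rmult_le_reg_l (2 * (Lf * c))); nra.
Qed.

Lemma lipschitz_normsq {p} (g : vec p -> vec p) Lf y z :
  0 < Lf -> norm (vsub (g y) (g z)) <= Lf * norm (vsub y z) ->
  normsq (vsub (g y) (g z)) <= Lf ^ 2 * normsq (vsub y z).
Proof.
move=> L0 lip; rewrite -(sqrt_sqrt (normsq (vsub (g y) _))); last exact: normsq_ge0.
rewrite -(sqrt_sqrt (normsq (vsub y z))); last exact: normsq_ge0.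
rewrite -/(norm (vsub (g y) (g z))) -/(norm (vsub y z)).
have := sqrt_pos (normsq (vsub (g y) (g z))); rewrite -/(norm _) => n0.
have := Rmult_le_compat _ _ _ _ n0 n0 lip lip; lra.
Qed.

(** * Convergence of the algorithm *)

Section primal_dual.
Context {n p : nat} {A : 'I_n -> 'I_n -> R}.
Context {fs : 'I_n -> vec p -> R} {gs : 'I_n -> vec p -> vec p}.
Context {Lf rho rho2 fstar alpha beta eta : R} {x v : nat -> svec n p}.
Context (n_gt0 : (0 < n)%nat) (wA : weighted_undirected A) (connA : graph_connected A).
Let L := laplacian A.
Context (Hrho : is_largest_eigenvalue L rho) (Hrho2 : is_smallest_pos_eigenvalue L rho2).
Context (fstar_min : forall y, fstar <= fglob fs y).
Context (Lf_gt0 : 0 < Lf) (Hgrad : forall i, is_gradient (fs i) (gs i)).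
Context (lip : forall i y z, normsq (vsub (gs i y) (gs i z)) <= Lf ^ 2 * normsq (vsub y z)).
Context (beta_gt0 : 0 < beta) (beta_alpha : beta < alpha) (eta_gt0 : 0 < eta).
Context (Halg : algorithm1 L gs alpha beta eta x v).
Let symA : symmetric A. Proof. by case: wA. Qed.
Let nR : 0 < INR n := lt_0_INR n (ltP n_gt0).

Let X k := center (x k).
Let s k := center (vshift gs beta x v k).
Let h k := slin 1 (gk gs x k) (-1) (g0k gs x k).
Let G k := snormsq (Hmul (gk gs x k)).
Let G0 k := snormsq (Hmul (g0k gs x k)).

(** Increments of [v] lie in the range of the Laplacian, so the zero sum at the start persists. *)
Lemma balanced_v k : balanced (v k).
Proof.
case: Halg => v0 [_ vS] c; elim: k => [|k IH]; first exact: v0.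
rewrite (sumR_ext _ (fun i => v k i c + eta * beta * smul L (x k) i c)).
  2: by move=> i; exact: vS.
by rewrite sumRD sumRZ IH balanced_smul //; ring.
Qed.

Lemma xbar_step k : xbar x k.+1 = vadd (xbar x k) (vscale (- eta) (savg (gk gs x k))).
Proof.
case: Halg => _ [xS _]; rewrite /xbar.
have -> : x k.+1 = slin 1 (x k) (- eta)
    (slin alpha (smul L (x k)) 1 (slin beta (v k) 1 (gk gs x k))).
  by apply: svec_ext => i c; rewrite xS /slin /vlin /smul /mv /gk; ring.
rewrite !savg_lin; apply: functional_extensionality => c.
rewrite /vlin /vadd /vscale (savg_balanced (smul L (x k))); last exact: balanced_smul.
by rewrite (savg_balanced (v k) c (balanced_v k)); ring.
Qed.

Lemma snormsq_gradient_deviation k : snormsq (h k) <= Lf ^ 2 * snormsq (X k).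
Proof.
rewrite /snormsq -sumRZ; apply: sumR_le => i.
have -> : h k i = vsub (gs i (x k i)) (gs i (xbar x k)).
  by apply: functional_extensionality => c; rewrite /h /slin /vlin /vsub /gk /g0k; ring.
exact: lip.
Qed.

Let delta k := slin 1 (g0k gs x k.+1) (-1) (g0k gs x k).

Lemma snormsq_gradient_drift k : snormsq (delta k) <= Lf ^ 2 * eta ^ 2 * G k.
Proof.
apply: (Rle_trans _ (sumR (fun _ : 'I_n => Lf ^ 2 * (eta ^ 2 * normsq (savg (gk gs x k)))))).
  apply: sumR_le => i.
  have -> : delta k i = vsub (gs i (xbar x k.+1)) (gs i (xbar x k)).
    by apply: functional_extensionality => c; rewrite /delta /slin /vlin /vsub /g0k; ring.
  apply: (Rle_trans _ _ _ (lip i _ _)).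
  have -> : vsub (xbar x k.+1) (xbar x k) = vscale (- eta) (savg (gk gs x k)).
    by apply: functional_extensionality => c; rewrite xbar_step /vsub /vadd; ring.
  by rewrite normsq_scale; right; ring.
by rewrite sumR_const /G snormsq_Hmul; right; ring.
Qed.

(** Summing [descent] over the agents produces - eta <Hg0, Hg>. Polarization turns it into - eta / 2
    (|Hg|^2 + |Hg0|^2 - |H(g - g0)|^2), whose last norm is at most Lf^2 |X|^2. *)
Lemma global_descent k :
  INR n * fglob fs (xbar x k.+1) <= INR n * fglob fs (xbar x k)
    - eta / 2 * (G k + G0 k - Lf ^ 2 * snormsq (X k)) + Lf / 2 * eta ^ 2 * G k.
Proof.
have nf y : INR n * fglob fs y = sumR (fun i => fs i y) by rewrite /fglob; field; lra.
set w := vscale (- eta) (savg (gk gs x k)).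
have step i : fs i (xbar x k.+1)
    <= fs i (xbar x k) + (dot (gs i (xbar x k)) w + Lf / 2 * normsq w).
  by rewrite xbar_step -Rplus_assoc; apply: descent.
have := sumR_le _ _ step; rewrite -nf !sumRD -nf sumR_const normsq_scale.
have -> : sumR (fun i => dot (gs i (xbar x k)) w)
    = INR n * (- eta * dot (savg (g0k gs x k)) (savg (gk gs x k))).
  rewrite -dot_scale -/w /dot sumR_exchange -sumRZ; apply: sumR_ext => c.
  rewrite (sumR_ext _ (fun i => w c * g0k gs x k i c)); last by move=> i; rewrite /g0k; ring.
  by rewrite sumRZ sum_savg //; ring.
have := snormsq_Hmul_le n_gt0 (h k); have := snormsq_gradient_deviation k.
rewrite /G /G0 !snormsq_Hmul savg_lin normsq_lin.
rewrite (dotC (savg (gk gs x k))) => hX Hh.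
have := Rmult_le_compat_l (eta / 2) _ _ (ltac:(lra)) (Rle_trans _ _ _ Hh hX).
lra.
Qed.

(** The split beta v + g = beta (v + g0 / beta) + (g - g0) brings the update into the form that
    [lyapunov_step] expects. *)
Lemma center_x_step k :
  X k.+1 = slin 1 (X k) (- eta) (slin 1 (slin alpha (smul L (X k)) beta (s k)) 1 (center (h k))).
Proof.
case: Halg => _ [xS _].
rewrite /X smul_center -(center_balanced (smul L (x k))); last exact: balanced_smul.
rewrite -!center_lin; congr center; apply: svec_ext => i c.
rewrite xS /slin /vlin /h /slin /vlin /vshift /gk /smul /mv; field; lra.
Qed.

Lemma center_vshift_step k :
  s k.+1 = slin 1 (slin 1 (s k) (eta * beta) (smul L (X k))) (/ beta) (center (delta k)).
Proof.
case: Halg => _ [_ vS].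
rewrite /X smul_center -(center_balanced (smul L (x k))); last exact: balanced_smul.
rewrite -!center_lin; congr center; apply: svec_ext => i c.
by rewrite /vshift vS /slin /vlin /delta /slin /vlin /smul /mv; ring.
Qed.

Let V k y := lyapunov L alpha beta (X k) y + INR n * (fglob fs (xbar x k) - fstar).

Lemma WkE k : Wk gs beta x v k = snormsq (X k) + snormsq (s k) + G k + G0 k.
Proof. by rewrite /Wk Knormsq_center. Qed.

Lemma VhatE k :
  Vhat fs gs fstar beta x v k
  = snormsq (X k) + snormsq (s k) + INR n * (fglob fs (xbar x k) - fstar).
Proof. by rewrite /Vhat !Knormsq_center. Qed.

Lemma lyapunov_descent k y : smul L y = s k ->
  exists2 y', smul L y' = s k.+1
  & V k.+1 y' + epsilon7 Lf rho rho2 alpha beta eta * Wk gs beta x v k <= V k y.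
Proof.
move=> Ly; have [z Lz] := smul_range wA connA Hrho2 _ (balanced_center n_gt0 (delta k)).
exists (slin 1 (slin 1 y (eta * beta) (X k)) (/ beta) z).
  by rewrite !smul_lin Ly Lz center_vshift_step.
have hX : snormsq (center (h k)) <= Lf ^ 2 * snormsq (X k).
  exact: Rle_trans _ _ _ (snormsq_center_le n_gt0 _) (snormsq_gradient_deviation k).
have D := Rle_trans _ _ _ (snormsq_center_le n_gt0 _) (snormsq_gradient_drift k).
have := lyapunov_step n_gt0 wA connA Hrho Hrho2 _ _ _ _ (X k) y z (center (h k))
  beta_gt0 beta_alpha eta_gt0 (balanced_center n_gt0 _) hX.
rewrite -/L Ly Lz -center_x_step /V => step.
have := global_descent k.
have ri := Rinv_0_lt_compat _ (rho2_gt0 Hrho2).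
have bi := Rinv_0_lt_compat _ beta_gt0; have ei := Rinv_0_lt_compat _ eta_gt0.
have ab : 0 < alpha / beta by apply: Rmult_lt_0_compat; lra.
set c := (_ / eta + _) in step.
have c_ge0 : 0 <= c.
  rewrite /c; have -> : / (2 * beta) = / 2 * / beta by field; lra.
  have -> : / beta ^ 2 = / beta * / beta by field; lra.
  by apply: Rplus_le_le_0_compat; apply: Rmult_le_pos; nra.
have := Rmult_le_compat_l c _ _ c_ge0 D.
(* The drift bound carries eta^2, so the 1 / eta part of [c] becomes the [epsilon5] term and the
   rest the [epsilon6] term. *)
have -> : c * (Lf ^ 2 * eta ^ 2 * G k)
  = eta * (/ 4 - epsilon5 Lf rho2 alpha beta + eta * epsilon6 Lf rho2 alpha beta
           - eta * (Lf * (1 + Lf) / 2)) * G k.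
  have r2 := rho2_gt0 Hrho2.
  by rewrite /c /epsilon5 /epsilon6; field; lra.
rewrite WkE /epsilon7; set m := Rmin _ _.
have [m1 [m2 [m3 m4]]] : m <= epsilon1 Lf rho2 alpha beta - eta * epsilon2 Lf rho alpha beta
    /\ m <= epsilon3 rho2 alpha beta - eta * epsilon4 beta
    /\ m <= epsilon5 Lf rho2 alpha beta - eta * epsilon6 Lf rho2 alpha beta
    /\ m <= / 4.
  rewrite /m; split; first exact: Rle_trans _ _ _ (Rmin_l _ _) (Rmin_l _ _).
  split; first exact: Rle_trans _ _ _ (Rmin_l _ _) (Rmin_r _ _).
  by split; apply: Rle_trans _ _ _ (Rmin_r _ _) _; [exact: Rmin_l | exact: Rmin_r].
have scale a b c' : a <= b -> 0 <= c' -> eta * a * c' <= eta * b * c'.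
  by move=> *; apply: Rmult_le_compat_r => //; apply: Rmult_le_compat_l; lra.
have := scale _ _ _ m1 (snormsq_ge0 (X k)); have := scale _ _ _ m2 (snormsq_ge0 (s k)).
have Gk0 : 0 <= G k by exact: snormsq_ge0.
have G0k0 : 0 <= G0 k by exact: snormsq_ge0.
have := scale _ _ _ m3 Gk0; have := scale _ _ _ m4 G0k0.
(* Left over on the decreasing side: eta / 4 of both [G] and [G0], and eta^2 Lf^2 / 2 of [G]. *)
have := scale 0 (/ 4) _ (ltac:(lra)) Gk0; have := scale 0 (/ 4) _ (ltac:(lra)) G0k0.
have : 0 <= eta ^ 2 * Lf ^ 2 * G k.
  by apply: Rmult_le_pos => //; apply: Rmult_le_pos; apply: pow2_ge_0.
lra.
Qed.

Lemma lyapunov_lower k y : smul L y = s k -> INR n * (fglob fs (xbar x k) - fstar) <= V k y.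
Proof.
move=> Ly; rewrite /V /lyapunov Ly.
have := smul_psd wA y; rewrite -/L Ly; have := young 1 (X k) (-1) (s k).
(* The part 1 / 2 completes the square |X + s|^2 / 2; the rest is nonnegative since alpha > beta. *)
have -> : alpha / (2 * beta) = / 2 + (alpha - beta) * (/ beta * / 2) by field; lra.
have : 0 <= (alpha - beta) * (/ beta * / 2) * snormsq (s k).
  apply: Rmult_le_pos (snormsq_ge0 _); apply: Rmult_le_pos; first lra.
  by have := Rinv_0_lt_compat _ beta_gt0; lra.
have := young 1 (X k) 1 (s k).
lra.
Qed.

(** After Young, |s|^2 has coefficient exactly [epsilon8], while |X|^2 and the gap of f have
    coefficient 1 <= epsilon8. *)
Lemma lyapunov_upper k y : smul L y = s k ->
  V k y <= epsilon8 rho2 alpha beta * Vhat fs gs fstar beta x v k.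
Proof.
move=> Ly; rewrite VhatE /V /lyapunov Ly.
have r2 := rho2_gt0 Hrho2.
have ys : ip y (s k) <= / rho2 * snormsq (s k).
  apply: (Rmult_le_reg_l rho2) => //; rewrite -Rmult_assoc Rinv_r; last lra.
  by rewrite Rmult_1_l -Ly; apply: (smul_inverse_bound n_gt0 wA connA Hrho2).
have -> : epsilon8 rho2 alpha beta = alpha / (2 * beta) + / 2 + / rho2 / 2.
  by rewrite /epsilon8; field; lra.
have ab : / 2 <= alpha / (2 * beta).
  by apply: (Rmult_le_reg_r (2 * beta)); [lra | rewrite /Rdiv Rmult_assoc Rinv_l; lra].
have ri := Rinv_0_lt_compat _ r2.
have f0 : 0 <= INR n * (fglob fs (xbar x k) - fstar).
  by apply: Rmult_le_pos; [lra | have := fstar_min (xbar x k); lra].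
have := young 1 (X k) (-1) (s k); have := young 1 (X k) 1 (s k).
have scale c : 0 <= c ->
    c <= (alpha / (2 * beta) + / 2 + / rho2 / 2) * c.
  by move=> c0; rewrite -{1}(Rmult_1_l c); apply: Rmult_le_compat_r; lra.
have := scale _ f0; have := scale _ (snormsq_ge0 (X k)).
lra.
Qed.

(** Each preimage is built from the preceding one, so the two ends are produced together by
    induction. *)
Lemma lyapunov_telescope T : exists y y0,
  [/\ smul L y0 = s 0, smul L y = s T.+1
    & V T.+1 y + epsilon7 Lf rho rho2 alpha beta eta * sum_f_R0 (Wk gs beta x v) T <= V 0 y0].
Proof.
elim: T => [|T [y [y0 [Ly0 Ly le_V]]]].
  have [y0 Ly0] := smul_range wA connA Hrho2 _ (balanced_center n_gt0 (vshift gs beta x v 0)).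
  by have [y Ly le_V] := lyapunov_descent 0 y0 Ly0; exists y, y0.
have [y' Ly' le_V'] := lyapunov_descent T.+1 y Ly.
by exists y', y0; split => //; rewrite [sum_f_R0 _ _]/=; lra.
Qed.

Lemma primal_dual_rate T :
  epsilon7 Lf rho rho2 alpha beta eta * sum_f_R0 (Wk gs beta x v) T
    + INR n * (fglob fs (xbar x T.+1) - fstar)
  <= epsilon8 rho2 alpha beta * Vhat fs gs fstar beta x v 0.
Proof.
have [y [y0 [Ly0 Ly le_V]]] := lyapunov_telescope T.
by have := lyapunov_lower _ _ Ly; have := lyapunov_upper _ _ Ly0; lra.
Qed.

Lemma Wk_ge0 k : 0 <= Wk gs beta x v k.
Proof.
rewrite WkE; have := snormsq_ge0 (X k); have := snormsq_ge0 (s k).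
by have := snormsq_ge0 (Hmul (gk gs x k)); have := snormsq_ge0 (Hmul (g0k gs x k));
  rewrite /G /G0; lra.
Qed.

End primal_dual.

(** Both bounds come from [primal_dual_rate]: one discards the nonnegative gap of f, the other the
    nonnegative sum of the W_k. *)
Theorem theorem1
  (n p : nat) (A : 'I_n -> 'I_n -> R)
  (fs : 'I_n -> vec p -> R) (gs : 'I_n -> vec p -> vec p)
  (Lf rho rho2 fstar kappa2 alpha beta eta : R)
  (x v : nat -> svec n p)
  (HA : weighted_undirected A)
  (HA1 : graph_connected A)
  (Hrho : is_largest_eigenvalue (laplacian A) rho)
  (Hrho2 : is_smallest_pos_eigenvalue (laplacian A) rho2)
  (HA2 : (exists xs : vec p, fglob fs xs = fstar) /\
         (forall y : vec p, fstar <= fglob fs y))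
  (HLf : 0 < Lf)
  (Hgrad : forall i, is_gradient (fs i) (gs i))
  (HLip : forall i (y z : vec p), norm (vsub (gs i y) (gs i z)) <= Lf * norm (vsub y z))
  (Hk2 : 1 < kappa2)
  (Hbeta : Rmax (Rmax (kappa_1 Lf rho2 / (kappa2 - 1)) (kappa_3 kappa2 rho2))
                (kappa_4 Lf kappa2 rho2) < beta)
  (Halpha : beta + kappa_1 Lf rho2 < alpha /\ alpha <= kappa2 * beta)
  (Heta : 0 < eta /\
          eta < Rmin (Rmin (epsilon1 Lf rho2 alpha beta / epsilon2 Lf rho alpha beta)
                           (epsilon3 rho2 alpha beta / epsilon4 beta))
                     (epsilon5 Lf rho2 alpha beta / epsilon6 Lf rho2 alpha beta))
  (Halg : algorithm1 (laplacian A) gs alpha beta eta x v) :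
  forall T : nat,
    / INR (S T) * sum_f_R0 (fun k => Wk gs beta x v k) T
      <= epsilon8 rho2 alpha beta * Vhat fs gs fstar beta x v 0
         / (epsilon7 Lf rho rho2 alpha beta eta * INR (S T))
    /\ fglob fs (xbar x (S T)) - fstar
      <= epsilon8 rho2 alpha beta * Vhat fs gs fstar beta x v 0 / INR n.
Proof.
have n_gt0 := eigenvalue_dim _ _ (proj1 Hrho).
have r2 := rho2_gt0 Hrho2; have r2_r := rho2_le_rho Hrho Hrho2.
have k2r : 0 < kappa2 + / rho2 by have := Rinv_0_lt_compat _ r2; lra.
(* [beta] exceeds [kappa_4], which is nonnegative. *)
have beta_gt0 : 0 < beta.
  apply: Rle_lt_trans (Rle_lt_trans _ _ _ (Rmax_r _ _) Hbeta); rewrite /kappa_4.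
  apply: Rplus_le_le_0_compat; apply: Rmult_le_pos; try lra.
    exact: pow2_ge_0.
  exact: sqrt_pos.
have beta_alpha : beta < alpha.
  have : 0 < kappa_1 Lf rho2 by apply: Rdiv_lt_0_compat; [have := pow2_ge_0 Lf; lra | lra].
  by case: Halpha; lra.
case: Heta => eta_gt0 eta_lt.
have ab : 0 < alpha / beta by apply: Rdiv_lt_0_compat; lra.
have Lf2 : 0 < Lf ^ 2 by apply: pow_lt.
(* Each quotient bounding [eta] makes one entry of the minimum in [epsilon7] positive, once its
   denominator is known to be positive. *)
have below a b : 0 < b -> eta < a / b -> 0 < a - eta * b.
  move=> b0 /(Rmult_lt_compat_r b _ _ b0); rewrite /Rdiv Rmult_assoc Rinv_l; lra.
have e7 : 0 < epsilon7 Lf rho rho2 alpha beta eta.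
  apply: Rmult_lt_0_compat => //.
  apply: Rmin_glb_lt; apply: Rmin_glb_lt; last lra; apply: below.
  - rewrite /epsilon2; have : 0 < rho by lra.
    have := pow2_ge_0 alpha; have := pow2_ge_0 rho; have := pow_lt _ 2 beta_gt0; nra.
  - exact: Rlt_le_trans _ _ _ eta_lt (Rle_trans _ _ _ (Rmin_l _ _) (Rmin_l _ _)).
  - by rewrite /epsilon4; have := pow2_ge_0 beta; lra.
  - exact: Rlt_le_trans _ _ _ eta_lt (Rle_trans _ _ _ (Rmin_l _ _) (Rmin_r _ _)).
  - rewrite /epsilon6; apply: Rplus_lt_0_compat; last by nra.
    apply: Rmult_lt_0_compat => //; apply: Rmult_lt_0_compat.
      by apply: Rinv_0_lt_compat; apply: pow_lt.
    by have := Rinv_0_lt_compat _ r2; lra.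
  - exact: Rlt_le_trans _ _ _ eta_lt (Rmin_r _ _).
have lip i y z := lipschitz_normsq (gs i) Lf y z HLf (HLip i y z).
move=> T; have nR := lt_0_INR n (ltP n_gt0); have TR := lt_0_INR T.+1 (Nat.lt_0_succ T).
have rate := primal_dual_rate n_gt0 HA HA1 Hrho Hrho2 (proj2 HA2) HLf Hgrad lip
  beta_gt0 beta_alpha eta_gt0 Halg T.
have sumW : 0 <= sum_f_R0 (Wk gs beta x v) T by apply: cond_pos_sum => k; apply: Wk_ge0.
have gap : 0 <= INR n * (fglob fs (xbar x T.+1) - fstar).
  by apply: Rmult_le_pos; [lra | have := proj2 HA2 (xbar x T.+1); lra].
split.
  have -> : epsilon8 rho2 alpha beta * Vhat fs gs fstar beta x v 0
      / (epsilon7 Lf rho rho2 alpha beta eta * INR T.+1)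
    = / INR T.+1 * (epsilon8 rho2 alpha beta * Vhat fs gs fstar beta x v 0
                    / epsilon7 Lf rho rho2 alpha beta eta) by field; lra.
  apply: Rmult_le_compat_l; first by apply: Rlt_le; apply: Rinv_0_lt_compat.
  apply: (Rmult_le_reg_l (epsilon7 Lf rho rho2 alpha beta eta)) => //.
  have -> : epsilon7 Lf rho rho2 alpha beta eta
    * (epsilon8 rho2 alpha beta * Vhat fs gs fstar beta x v 0
       / epsilon7 Lf rho rho2 alpha beta eta)
    = epsilon8 rho2 alpha beta * Vhat fs gs fstar beta x v 0 by field; lra.
  by move: rate; rewrite -[sum_f_R0 (fun k => _) T]/(sum_f_R0 (Wk gs beta x v) T); lra.
apply: (Rmult_le_reg_l (INR n)) => //.
have -> : INR n * (epsilon8 rho2 alpha beta * Vhat fs gs fstar beta x v 0 / INR n)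
  = epsilon8 rho2 alpha beta * Vhat fs gs fstar beta x v 0 by field; lra.
by have := Rmult_le_pos _ _ (Rlt_le _ _ e7) sumW; lra.
Qed.
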